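(* Let $c>0$, let $\beta\in\mathcal F^0_{\mathrm{inc}}$ be $c$-Lipschitz, and for $f\in\{1,\dots,M\}$ let $\alpha_{\mathrm{pkt},f}$ be a sub-additive left-continuous packet-level arrival curve and $L_f^{\max}$ a maximum packet length. Then there exists a simulation trace of a FIFO system shared by $M$ flows, with transmission rate $c$ and offering service curve $\beta$ to the aggregate of the flows, in which every flow $f$ has packet-level arrival curve $\alpha_{\mathrm{pkt},f}$ and packet lengths at most $L_f^{\max}$, and in which some packet of flow $1$ has response time equal to $$\Delta^{\mathrm{pkt}}=h\Big(\sum_{i=1}^{M}L_i^{\max}\alpha_{\mathrm{pkt},i}^{+}-L_1^{\max},\,\beta\Big)+\frac{L_1^{\max}}{c}.$$
   Context: Functions. $\mathcal F^0_{\mathrm{inc}}$ is the set of wide-sense increasing functions $w:[0,\infty)\to[0,\infty]$ with $w(0)=0$. $w^+$ denotes the right limit of $w$. The lower pseudo-inverse is $w^{\downarrow}(x)=\inf\{s\ge 0: w(s)\ge x\}$. The horizontal deviation is $h(w',w)=\sup_{t\ge 0}\{w^{\downarrow}(w'(t))-t\}$. $w$ is $c$-Lipschitz if $|w(t_2)-w(t_1)|\le c|t_2-t_1|$ for all $t_1,t_2\ge0$. FIFO system and trace. Packets are numbered $n=1,2,\dots$ in order of arrival, all flows together; packet $n$ has length $l_n>0$ (bits) and arrival time $A_n\ge0$, $A_n\le A_{n+1}$ (simultaneous arrivals may be ordered arbitrarily), and belongs to one flow. All bits of a packet arrive at the same instant (packetized input). Packet $n$ starts transmission at time $Q_n\ge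 A_n$, with $Q_n\le Q_{n+1}$ (FIFO), and is transmitted without preemption at constant rate $c$, leaving at $D_n=Q_n+l_n/c$ (at most one packet is in transmission at a time). The response time of packet $n$ is $D_n-A_n$. Let $\mathcal A(t)$ (resp. $\mathcal D(t)$) be the cumulative number of bits arrived at (resp. departed from) the system until time $t$ (excluded). The system offers service curve $\beta\in\mathcal F^0_{\mathrm{inc}}$ if for every $t\ge 0$ there is $s\in[0,t]$ with $\mathcal D(t)\ge\beta(t-s)+\mathcal A(s)$. A simulation trace is a (finite or infinite) packet sequence, with flow membership, lengths, arrival times and transmission start times, satisfying all these requirements. Packet-level arrival curve. Let $N(t)$ be the number of packets of a flow arrived until time $t$ (excluded). The flow has packet-level arrival curve $\alpha_{\mathrm{pkt}}$ (a wide-sense increasing function from $[0,\infty)$ to the nonnegative integers with $\alpha_{\mathrm{pkt}}(0)=0$) if $N(t)-N(s)\le\alpha_{\mathrm{pkt}}(t-s)$ for all $0\le s\le t$. Standing assumption: $\alpha_{\mathrm{pkt}}^+(0)\ge1$.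
   Formalization: Equality with Δ^pkt is proved when the supremum defining h is a finite maximum; otherwise equality can fail (e.g. β=0 gives Δ^pkt=+∞). Without that condition, it is proved that for every real r<Δ^pkt some such trace has a flow-1 packet with response time above r. *)

(* Defs.v *)
(* MathComp-Analysis; functions on [0, +oo) are total functions on R whose
   values at negative arguments are never constrained nor used. *)
From HB Require Import structures.
From mathcomp Require Import all_boot all_order all_algebra.
From mathcomp Require Import all_classical all_reals all_analysis.

Set Implicit Arguments.
Unset Strict Implicit.
Unset Printing Implicit Defensive.

Import Order.TTheory GRing.Theory Num.Theory.
Import numFieldNormedType.Exports.

Local Open Scope classical_set_scope.
Local Open Scope ring_scope.

Section Curves.
Variable R : realType.

(* The class F^0_inc of functions [0, +oo) -> [0, +oo]. *)
Definition Finc0 (w : R -> \bar R) : Prop :=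
  [/\ forall t : R, 0 <= t -> (0 <= w t)%E,
      forall s t : R, 0 <= s -> s <= t -> (w s <= w t)%E
    & w 0 = 0%E].

(* As +oo - +oo = -oo in \bar R, this forces w to be finite everywhere as soon
   as w 0 is finite. *)
Definition lipschitz_curve (c : R) (w : R -> \bar R) : Prop :=
  forall t1 t2 : R, 0 <= t1 -> 0 <= t2 ->
    (`|w t2 - w t1| <= (c * `|t2 - t1|)%:E)%E.

(* The infimum of the empty set is +oo. *)
Definition lower_pinv (w : R -> \bar R) (x : \bar R) : \bar R :=
  ereal_inf [set s%:E | s in [set s : R | 0 <= s /\ (x <= w s)%E]].

Definition hdev (w' w : R -> \bar R) : \bar R :=
  ereal_sup [set (lower_pinv w (w' t) - t%:E)%E | t in [set t : R | 0 <= t]].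

Definition right_lim (w : R -> R) (t : R) : R := lim (w u @[u --> t^'+]).

(* Wide-sense increasing a : [0, +oo) -> nat with a(0) = 0 and a^+(0) >= 1. *)
Definition packet_curve (a : R -> nat) : Prop :=
  [/\ forall s t : R, 0 <= s -> s <= t -> (a s <= a t)%N,
      a 0 = 0%N
    & 1 <= right_lim (fun u => (a u)%:R) 0].

Definition sub_additive (a : R -> nat) : Prop :=
  forall s t : R, 0 <= s -> 0 <= t -> (a (s + t)%R <= a s + a t)%N.

Definition left_continuous (a : R -> nat) : Prop :=
  forall t : R, 0 < t -> ((a u)%:R : R) @[u --> t^'-] --> ((a t)%:R : R).

End Curves.

(* Packets are numbered from 0 in order of arrival. [tr_size] is [Some k] for a
   trace of k packets and [None] for an infinite one; the other fields are
   meaningful only at indices satisfying [is_pkt]. *)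
Record trace (R : realType) (M : nat) := Trace {
  tr_size : option nat;
  flow : nat -> 'I_M;
  len : nat -> R;
  arr : nat -> R;
  start : nat -> R }.

Section Traces.
Variables (R : realType) (M : nat) (T : trace R M).

Definition is_pkt (n : nat) : bool :=
  if tr_size T is Some k then (n < k)%N else true.

Definition departure (c : R) (n : nat) : R := start T n + len T n / c.

Definition response_time (c : R) (n : nat) : R := departure c n - arr T n.

Definition fifo_trace (c : R) : Prop :=
  (forall n, is_pkt n ->
     [/\ 0 < len T n, 0 <= arr T n & arr T n <= start T n]) /\
  (forall n, is_pkt n.+1 ->
     [/\ arr T n <= arr T n.+1, start T n <= start T n.+1
       & departure c n <= start T n.+1]).

(* Bits arrived strictly before t. *)
Definition bits_in (t : R) : \bar R :=
  (\sum_(0 <= n <oo | is_pkt n && (arr T n < t)%R) (len T n)%:E)%E.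

(* Bits departed before t: packet n leaves the system bit by bit at rate c
   during [start n, departure n], hence contributes
   min (l_n, c * max (0, t - Q_n)). *)
Definition bits_out (c t : R) : \bar R :=
  (\sum_(0 <= n <oo | is_pkt n)
     (Num.min (len T n) (c * Num.max 0 (t - start T n)))%:E)%E.

Definition offers_service_curve (c : R) (beta : R -> \bar R) : Prop :=
  forall t : R, 0 <= t -> exists s : R,
    [/\ 0 <= s, s <= t & (beta (t - s)%R + bits_in s <= bits_out c t)%E].

(* Packets of flow f arrived strictly before t. *)
Definition pkts_in (f : 'I_M) (t : R) : \bar R :=
  (\sum_(0 <= n <oo | [&& is_pkt n, flow T n == f & (arr T n < t)%R]) 1)%E.

(* Taking s = 0 shows that pkts_in f is finite under this constraint. *)
Definition has_packet_curve (f : 'I_M) (a : R -> nat) : Prop :=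
  forall s t : R, 0 <= s -> s <= t ->
    (pkts_in f t - pkts_in f s <= (a (t - s)%R)%:R%:E)%E.

Definition max_packet_length (f : 'I_M) (l : R) : Prop :=
  forall n, is_pkt n -> flow T n = f -> len T n <= l.

End Traces.

Section Bound.
Variables (R : realType) (M : nat).
Variables (c : R) (beta : R -> \bar R).
Variables (alpha : 'I_M -> R -> nat) (L : 'I_M -> R).

Definition admissible_trace (T : trace R M) : Prop :=
  [/\ fifo_trace T c,
      offers_service_curve T c beta,
      forall f, has_packet_curve T f (alpha f)
    & forall f, max_packet_length T f (L f)].

Definition interfering_bits (f : 'I_M) (t : R) : \bar R :=
  (\sum_i L i * right_lim (fun u => (alpha i u)%:R) t - L f)%:E.

Definition Delta_pkt (f : 'I_M) : \bar R :=
  (hdev (interfering_bits f) beta + (L f / c)%:E)%E.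

(* The supremum defining the horizontal deviation in [Delta_pkt] is a finite
   maximum. It may fail to be one: for one flow with L = 1, beta(t) = t, c = 1
   and alpha(t) = #{n | n^2 / (n + 1) < t}, the deviation is
   sup_n n / (n + 1) = 1, so Delta_pkt = 2, whereas every packet of every
   admissible trace has response time < 2. *)
Definition hdev_attained (f : 'I_M) : Prop :=
  exists2 t : R, 0 <= t &
    let d := (lower_pinv beta (interfering_bits f t) - t%:E)%E in
    d \is a fin_num /\ hdev (interfering_bits f) beta = d.

End Bound.

(* Main.v *)
(* Fix an instant t0. Every flow sends as early as its arrival curve permits,
   except that the last packet of flow 1 sent in [0, t0] is delayed to t0 and
   queued behind all others. Packet n starts at
     Q_n = max_{m <= n} (A_m + pinv(P_n - P_m)),
   with A_m the arrival times, P_m the bits preceding packet m, and pinv the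
   lower pseudo-inverse of the service curve; the maximising A_m (or t itself)
   witnesses the service curve property at t, and Lipschitz continuity of the
   curve leaves room for each transmission. Taking m = 0, the critical packet
   starts no earlier than pinv(x(t0)), x being the interfering bits. By
   sub-additivity at most x(t0 - A_m) bits precede it from packet m on, so it
   starts no later than t0 + h, with h the horizontal deviation. If t0 attains
   h, both bounds coincide; otherwise the lower bound alone approaches h. *)
Require Import Defs.
From HB Require Import structures.
From mathcomp Require Import all_boot all_order all_algebra.
From mathcomp Require Import all_classical all_reals all_analysis.
From mathcomp Require Import zify ring lra.

Import Order.TTheory GRing.Theory Num.Theory.
Import numFieldNormedType.Exports.

Local Open Scope classical_set_scope.
Local Open Scope ring_scope.

Lemma finite_eseries (R : realType) (K : nat) (P : pred nat) (f : nat -> R) :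
  (forall n, (n < K)%N -> P n -> 0 <= f n) ->
  (\sum_(0 <= n <oo | (n < K)%N && P n) (f n)%:E)%E =
  (\sum_(0 <= n < K | P n) f n)%:E.
Proof.
move=> f0.
rewrite (eq_eseriesl (Q := fun n => (true && ((n < K)%N && P n)))) //.
rewrite eseries_mkcondr (nneseries_split 0 K); last first.
  by move=> k _; case: ifP => // /andP[kK Pk]; rewrite lee_fin f0.
rewrite add0n eseries0 ?adde0; last first.
  by move=> k Kk _; rewrite ltnNge Kk.
rewrite -sumEFin [RHS]big_mkcond /= big_nat_cond [RHS]big_nat_cond.
by apply: eq_bigr => k; rewrite andbT => /= ->.
Qed.

(** * Lazy scheduling along a service curve *)

Section PseudoInverse.
Context {R : realType} (c : R) (b : R -> R).
Hypothesis c_gt0 : 0 < c.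
Hypothesis b0 : b 0 = 0.
Hypothesis b_lip : forall s t : R, 0 <= s -> s <= t -> b t <= b s + c * (t - s).
Hypothesis b_unbounded : forall x, exists2 s : R, 0 <= s & x <= b s.

(** Real-valued counterpart of [lower_pinv]; [b_unbounded] keeps the set nonempty, so [inf] never
    falls back on its default value. *)
Definition pinv (x : R) : R := inf [set s | 0 <= s /\ x <= b s].

Lemma pinv_le x s : 0 <= s -> x <= b s -> pinv x <= s.
Proof. by move=> s0 xs; apply: ge_inf => //; exists 0 => u []. Qed.

Lemma le_pinv x y : (forall s, 0 <= s -> x <= b s -> y <= s) -> y <= pinv x.
Proof.
move=> H; apply: lb_le_inf; last by move=> s [s0 xs]; exact: H.
by have [s s0 xs] := b_unbounded x; exists s.
Qed.

Lemma pinv_ge0 x : 0 <= pinv x.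
Proof. exact: le_pinv. Qed.

(** If [b] overshot [x] at the infimum, the Lipschitz bound would keep it at or above [x] slightly
    earlier. *)
Lemma curve_pinv x : 0 <= x -> b (pinv x) <= x.
Proof.
move=> x0; rewrite leNgt; apply/negP => xp.
have p0 := pinv_ge0 x.
have pe s : 0 <= s -> s < pinv x -> b s < x.
  by move=> s0 sp; rewrite ltNge; apply: contraTN sp => /(pinv_le _ _ s0); rewrite -leNgt.
set e := (b (pinv x) - x) / c.
have e0 : 0 < e by rewrite divr_gt0 // subr_gt0.
have ce : c * e = b (pinv x) - x by rewrite /e mulrC divfK // gt_eqF.
(* Stepping back by [e] must not lead to negative times, where [b] is unconstrained; that case
   contradicts [b 0 = 0] and [0 <= x]. *)
have [pe0|ep] := ltP (pinv x) e.
  have := b_lip _ _ (lexx 0) p0; rewrite b0 subr0 => bp.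
  have : c * pinv x < c * e by rewrite ltr_pM2l.
  by rewrite ce; lra.
have s0 : 0 <= pinv x - e by lra.
have := b_lip _ _ s0 (_ : pinv x - e <= pinv x); rewrite opprB addrCA subrr addr0 ce.
have := pe _ s0; lra.
Qed.

(** Climbing by [l] takes [b] at least [l / c]: where it reaches [x + l], it had reached [x] already
    [l / c] earlier. This gap accommodates the transmission of a packet. *)
Lemma pinv_add x l : 0 <= x -> 0 <= l -> pinv x + l / c <= pinv (x + l).
Proof.
move=> x0 l0; apply: le_pinv => s s0 xs.
have cl : c * (l / c) = l by rewrite mulrC divfK // gt_eqF.
have bs : b s <= c * s by have := b_lip _ _ (lexx 0) s0; rewrite b0 subr0 add0r.
have ls : 0 <= s - l / c.
  by rewrite subr_ge0 -(ler_pM2l c_gt0) cl; lra.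
have lc0 : 0 <= l / c by rewrite divr_ge0 // ltW.
rewrite -lerBrDr; apply: pinv_le => //.
have := b_lip _ _ ls (_ : s - l / c <= s); rewrite opprB addrCA subrr addr0 cl; lra.
Qed.

End PseudoInverse.

(** * FIFO and service curve properties of the lazy schedule *)

Section Schedule.
Context {R : realType} (c : R) (b : R -> R).
Hypothesis c_gt0 : 0 < c.
Hypothesis b_mono : forall s t : R, 0 <= s -> s <= t -> b s <= b t.
Hypothesis b0 : b 0 = 0.
Hypothesis b_lip : forall s t : R, 0 <= s -> s <= t -> b t <= b s + c * (t - s).
Hypothesis b_unbounded : forall x, exists2 s : R, 0 <= s & x <= b s.

Context (K : nat) (ar ln : nat -> R).
Hypothesis ln_gt0 : forall n, 0 < ln n.
Hypothesis ar_ge0 : forall n, (n < K)%N -> 0 <= ar n.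
Hypothesis ar_mono : forall m n, (m <= n)%N -> (n < K)%N -> ar m <= ar n.

(* Lazy start times for which the output still dominates the min-plus
   convolution of [b] with the arrivals: packet [n] waits until, for every
   earlier arrival instant [ar m], the curve [b] shifted to [ar m] has served
   all the packets [m, ..., n - 1]. *)
Definition lazy_start (n : nat) : R :=
  \big[Num.max/ar n]_(m < n.+1) (ar m + pinv b (\sum_(m <= j < n) ln j)).

Lemma lazy_start_ge n m : (m <= n)%N ->
  ar m + pinv b (\sum_(m <= j < n) ln j) <= lazy_start n.
Proof. by move=> mn; apply: (le_bigmax _ _ (Ordinal (mn : m < n.+1)%N)). Qed.

Lemma pinv0 : pinv b 0 = 0.
Proof.
apply/eqP; rewrite eq_le pinv_ge0 // andbT; apply: pinv_le => //.
by rewrite b0.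
Qed.

Lemma arr_le_start n : ar n <= lazy_start n.
Proof. exact: bigmax_ge_id. Qed.

Lemma lazy_start_eq n : exists2 m, (m <= n)%N &
  lazy_start n = ar m + pinv b (\sum_(m <= j < n) ln j).
Proof.
rewrite /lazy_start.
elim/big_ind: _ => [|x y [i i_n ->] [j j_n ->]|i _].
(* The initial value [ar n] of the maximum is the term m = n, as [pinv b 0 = 0]. *)
- by exists n => //; rewrite big_geq // pinv0 addr0.
- by rewrite /Num.max; case: ifP => _; [exists j|exists i].
- by exists i => //; rewrite -ltnS.
Qed.

Lemma bits_ge0 m n : 0 <= \sum_(m <= j < n) ln j.
Proof. by apply: sumr_ge0 => j _; apply: ltW. Qed.

(** An index attaining the maximum for [n] is also a candidate for [n.+1], and [pinv_add] supplies
    the transmission time. *)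
Lemma lazy_start_step n : lazy_start n + ln n / c <= lazy_start n.+1.
Proof.
have [m mn ->] := lazy_start_eq n.
apply: le_trans (lazy_start_ge _ m _); last exact: leqW.
by rewrite big_nat_recr //= -addrA lerD2l pinv_add // ?bits_ge0 // ltW.
Qed.

Context (M : nat) (fl : nat -> 'I_M).
Let T := Trace (Some K) fl ln ar lazy_start.

Lemma lazy_fifo : fifo_trace T c.
Proof.
split=> n; rewrite /is_pkt /= => nK.
  by split=> //; [exact: ar_ge0|exact: arr_le_start].
split; [exact: ar_mono| |exact: lazy_start_step].
apply: le_trans (lazy_start_step n).
by rewrite lerDl divr_ge0 // ltW.
Qed.

(** Arrivals are ordered, so no packet from [m] on arrives before [s]. The guard [m < K] admits
    [m = K], which covers all packets. *)
Lemma bits_before m s : (m <= K)%N -> ((m < K)%N -> s <= ar m) ->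
  \sum_(0 <= j < K | ar j < s) ln j <= \sum_(0 <= j < m) ln j.
Proof.
move=> mK sm; rewrite (big_cat_nat (n := m)) //= [X in _ + X]big_nat_cond.
rewrite [X in _ + X]big1 => [|i /andP[/andP[mi iK] si]]; last first.
  have := sm (leq_ltn_trans mi iK); have := ar_mono _ _ mi iK; lra.
rewrite addr0 big_mkcond /=; apply: ler_sum => i _.
by case: ifP => // _; apply: ltW.
Qed.

Lemma lazy_bits_in m s : (m <= K)%N -> ((m < K)%N -> s <= ar m) ->
  (bits_in T s <= (\sum_(0 <= j < m) ln j)%:E)%E.
Proof.
move=> mK sm; rewrite /bits_in finite_eseries; last by move=> *; apply: ltW.
by rewrite lee_fin; exact: bits_before.
Qed.

Lemma lazy_bits_out n t : (n < K)%N -> (forall m, (m < n)%N -> departure T c m <= t) ->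
  ((\sum_(0 <= j < n) ln j
     + Num.min (ln n) (c * Num.max 0 (t - lazy_start n)))%:E <= bits_out T c t)%E.
Proof.
move=> nK Ht.
have g0 j : 0 <= Num.min (ln j) (c * Num.max 0 (t - lazy_start j)).
  rewrite le_min (ltW (ln_gt0 _)) mulr_ge0 ?(ltW c_gt0) //.
  by rewrite le_max lexx.
rewrite /bits_out /is_pkt /=.
under eq_eseriesl => j do rewrite -[(j < K)%N]andbT.
rewrite (@finite_eseries _ _ xpredT) //= lee_fin.
rewrite [leRHS](big_cat_nat (n := n.+1)) //= big_nat_recr //=.
apply: ler_wpDr; first exact: sumr_ge0.
rewrite lerD2r big_nat_cond [leRHS]big_nat_cond; apply: ler_sum => j /andP[/andP[_ jn] _].
have := Ht _ jn; rewrite /departure /= => dj.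
rewrite le_min lexx /=.
have -> : ln j = c * (ln j / c) by rewrite mulrC divfK // gt_eqF.
by rewrite ler_pM2l // le_max; apply/orP; right; lra.
Qed.

(** Let [n] be the first packet departing after [t], and [m] an index attaining the maximum in its
    start time; the witness is the minimum of [t] and [ar m]. If every packet has departed by [t],
    the witness is [t]. *)
Lemma lazy_service (beta : R -> \bar R) :
  (forall t, 0 <= t -> (beta t <= (b t)%:E)%E) -> offers_service_curve T c beta.
Proof.
move=> beta_le t t0.
have [[n [nK tn Hn]]|done] : (exists n, [/\ (n < K)%N, t < departure T c n &
    forall m, (m < n)%N -> departure T c m <= t]) \/
    forall n, (n < K)%N -> departure T c n <= t.
  have [ex|nex] := pselect (exists n, (n < K)%N && (t < departure T c n)).
    left; have [n /andP[nK tn] nmin] := ex_minnP ex.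
    exists n; split=> // m mn; rewrite leNgt; apply/negP => tm.
    by have := nmin m; rewrite tm (ltn_trans mn nK) => /(_ isT); rewrite leqNgt mn.
  right=> n nK; rewrite leNgt; apply/negP => tn; apply: nex.
  by exists n; rewrite nK.
- have out := lazy_bits_out _ _ nK Hn.
  have [m mn Qn] := lazy_start_eq n.
  have mK := leq_ltn_trans mn nK.
  have b_pinv : b (pinv b (\sum_(m <= j < n) ln j)) <= \sum_(m <= j < n) ln j.
    by apply: (curve_pinv c) => //; exact: bits_ge0.
  have split_bits : \sum_(0 <= j < n) ln j =
      \sum_(0 <= j < m) ln j + \sum_(m <= j < n) ln j.
    by rewrite (big_cat_nat (n := m)).
  have min0 : 0 <= Num.min (ln n) (c * Num.max 0 (t - lazy_start n)).
    by rewrite le_min (ltW (ln_gt0 _)) mulr_ge0 ?(ltW c_gt0) // le_max lexx.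
  have bmn := bits_ge0 m n.
  have [tm|mt] := leP t (ar m).
    exists t; split=> //; apply: le_trans out; rewrite subrr.
    apply: (@le_trans _ _ (0 + (\sum_(0 <= j < m) ln j)%:E)%E).
      by apply: leeD; [have := beta_le _ (lexx 0); rewrite b0|apply: lazy_bits_in => //; exact: ltnW].
    by rewrite add0e lee_fin; lra.
  exists (ar m); split; [exact: ar_ge0|exact: ltW|].
  apply: le_trans out.
  apply: (@le_trans _ _ ((b (t - ar m))%:E + (\sum_(0 <= j < m) ln j)%:E)%E).
    by apply: leeD; [apply: beta_le; lra|apply: lazy_bits_in => //; exact: ltnW].
  rewrite -EFinD lee_fin.
  have p0 : 0 <= pinv b (\sum_(m <= j < n) ln j) by exact: pinv_ge0.
  (* Up to the start of [n], monotonicity and [b_pinv] suffice. Afterwards [b] grows by at most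
     [c * (t - lazy_start n)], exactly the bits of [n] already sent. *)
  have [tQ|Qt] := leP t (lazy_start n).
    have := b_mono (t - ar m) (pinv b (\sum_(m <= j < n) ln j)); lra.
  have pt : pinv b (\sum_(m <= j < n) ln j) <= t - ar m by lra.
  have := b_lip _ _ p0 pt.
  have -> : Num.min (ln n) (c * Num.max 0 (t - lazy_start n)) = c * (t - lazy_start n).
    rewrite max_r; last by lra.
    rewrite min_r //.
    have -> : ln n = c * (ln n / c) by rewrite mulrC divfK // gt_eqF.
    by rewrite ler_pM2l //; move: tn; rewrite /departure /=; lra.
  rewrite Qn opprD addrA; lra.
exists t; split=> //; rewrite subrr.
apply: (@le_trans _ _ (0 + (\sum_(0 <= j < K) ln j)%:E)%E).
  apply: leeD; [by have := beta_le _ (lexx 0); rewrite b0|].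
  by apply: lazy_bits_in => //; rewrite ltnn.
rewrite add0e.
case: (posnP K) => [K0|K_gt0].
  rewrite K0 big_geq //; apply: nneseries_ge0 => n _ _; rewrite lee_fin.
  by rewrite le_min (ltW (ln_gt0 _)) mulr_ge0 ?(ltW c_gt0) // le_max lexx.
(* The output bound is applied to the last packet, which is itself fully transmitted. *)
have KK : (K.-1 < K)%N by rewrite prednK.
apply: le_trans (lazy_bits_out _ _ KK _); last first.
  by move=> m mK; apply: done; apply: ltn_trans KK.
rewrite -{1}(prednK K_gt0) big_nat_recr //= lee_fin lerD2l.
rewrite le_min lexx /=.
have -> : ln K.-1 = c * (ln K.-1 / c) by rewrite mulrC divfK // gt_eqF.
rewrite ler_pM2l // le_max; apply/orP; right.
by have := done _ KK; rewrite /departure /=; lra.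
Qed.

End Schedule.

(** * Greedy arrivals *)

Section StepCurve.
Context {R : realType} (a : R -> nat).
Hypothesis a_mono : forall s t : R, 0 <= s -> s <= t -> (a s <= a t)%N.

(** A monotone integer-valued function is constant just to the right of [t], at the least value it
    takes there. *)
Lemma right_lim_nat (t : R) : 0 <= t -> exists k : nat,
  [/\ right_lim (fun u => (a u)%:R) t = k%:R,
      forall u, t < u -> (k <= a u)%N & exists2 u, t < u & a u = k].
Proof.
move=> t0.
have ex : exists k : nat, `[< exists2 u, t < u & a u = k >].
  by exists (a (t + 1)); apply/asboolP; exists (t + 1) => //; rewrite ltrDl.
have [k /asboolP[u tu auk] kmin] := ex_minnP ex.
have k_le v : t < v -> (k <= a v)%N.
  by move=> tv; apply: kmin; apply/asboolP; exists v.
exists k; split => //; last by exists u.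
apply: lim_near_cst; first exact: Rhausdorff.
near=> v.
have tv : t < v by near: v; exact: nbhs_right_gt.
congr _%:R; apply/eqP; rewrite eqn_leq k_le // andbT -auk a_mono //.
  by apply/ltW; apply: le_lt_trans tv.
by apply/ltW; near: v; exact: nbhs_right_lt.
Unshelve. all: by end_near. Qed.

Lemma right_lim_ge (t : R) (n : nat) : 0 <= t ->
  (forall u, t < u -> (n <= a u)%N) -> n%:R <= right_lim (fun u => (a u)%:R) t.
Proof.
move=> t0 nu; have [k [-> _ [u tu <-]]] := right_lim_nat _ t0.
by rewrite ler_nat nu.
Qed.

(* Greedy arrival time of the m-th packet, counted from 1. *)
Definition jump (m : nat) : R := inf [set s : R | 0 <= s /\ (m <= a s)%N].

Lemma jump_ge0 m : (exists2 s : R, 0 <= s & (m <= a s)%N) -> 0 <= jump m.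
Proof.
by move=> [s s0 ms]; apply: lb_le_inf => [|u []] //; exists s.
Qed.

(** Left-continuity of an integer-valued curve makes [m <= a s] an open condition from the left, so
    the infimum is not attained. This matches counting arrivals strictly before [t]. *)
Lemma jump_lt m (t : R) : a 0 = 0%N -> left_continuous a ->
  (exists2 s : R, 0 <= s & (m <= a s)%N) -> (0 < m)%N -> 0 <= t ->
  (jump m < t) = (m <= a t)%N.
Proof.
move=> a0 a_left [s s0 ms] m0 t0; apply/idP/idP.
  move=> /inf_lt[|u [u0 mu] ut]; first by exists s.
  by apply: leq_trans mu _; apply: a_mono => //; exact: ltW.
have jle u : 0 <= u -> (m <= a u)%N -> jump m <= u.
  by move=> u0 mu; apply: ge_inf => //; exists 0 => v [].
move=> mt; have t_gt0 : 0 < t.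
  rewrite lt_neqAle t0 andbT; apply/negP => /eqP t_eq0.
  by move: mt; rewrite -t_eq0 a0 leqNgt m0.
have /cvgrPdist_lt/(_ 1 ltr01) near1 := a_left _ t_gt0.
near t^'- => u.
have ut : u < t by near: u; exact: nbhs_left_lt.
have u0 : 0 < u by near: u; exact: nbhs_left_gt.
apply: le_lt_trans ut; apply: jle; first exact: ltW.
apply: leq_trans mt _.
have : `|(a t)%:R - (a u)%:R| < 1 :> R by near: u.
move=> /(le_lt_trans (ler_norm _)); rewrite ltrBlDr addrC natr1 ltr_nat ltnS.
by [].
Unshelve. all: by end_near. Qed.

End StepCurve.

Lemma count_leq_iota (n k : nat) :
  count (fun m => (m <= n)%N) (iota 1 k) = minn n k.
Proof.
elim: k => [|k IH]; first by rewrite minn0.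
rewrite -[k.+1]addn1 iotaD count_cat IH /= addn0 add1n; lia.
Qed.

Lemma sum_by_flow (R : realType) (M : nat) (S : Type) (L : 'I_M -> R)
    (s : seq ('I_M * S)) (Q : pred ('I_M * S)) :
  \sum_(p <- s | Q p) L p.1 =
  \sum_i L i * (count (fun p => (p.1 == i) && Q p) s)%:R.
Proof.
elim: s => [|p s IH] /=.
  by rewrite big_nil big1 // => i _; rewrite mulr0.
under [RHS]eq_bigr do rewrite natrD mulrDr.
rewrite big_cons IH big_split /=; case: ifP => Qp; last first.
  by rewrite [X in _ = X + _]big1 ?add0r // => i _; rewrite andbF mulr0.
congr (_ + _); rewrite (bigD1 p.1) //= eqxx mulr1 big1 ?addr0 // => i.
by rewrite eq_sym => /negPf ->; rewrite mulr0.
Qed.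

(** * Greedy arrivals of all flows up to a fixed instant *)

Section Greedy.
Context {R : realType} {M : nat} (alpha : 'I_M -> R -> nat).
Hypothesis alpha_curve : forall f, packet_curve (alpha f).
Hypothesis alpha_sub : forall f, sub_additive (alpha f).
Hypothesis alpha_left : forall f, left_continuous (alpha f).
Context (f1 : 'I_M) (t0 : R) (K : 'I_M -> nat).
Hypothesis t0_ge0 : 0 <= t0.
(** With [K_eq], this identifies [K f] as the right limit of [alpha f] at [t0]. *)
Hypothesis K_le : forall f u, t0 < u -> (K f <= alpha f u)%N.
Hypothesis K_eq : forall f, exists2 u, t0 < u & alpha f u = K f.

Lemma alpha_mono f (s t : R) : 0 <= s -> s <= t -> (alpha f s <= alpha f t)%N.
Proof. by case: (alpha_curve f) => + _ _; apply. Qed.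

Lemma alpha_gt0 f (u : R) : 0 < u -> (0 < alpha f u)%N.
Proof.
move=> u0; case: (alpha_curve f) => _ _.
have [k [-> k_le _]] := right_lim_nat _ (alpha_mono f) _ (lexx 0).
by rewrite (ler_nat _ 1) => k1; apply: leq_trans k1 (k_le _ u0).
Qed.

Lemma K_gt0 f : (0 < K f)%N.
Proof.
have [u tu <-] := K_eq f; apply: alpha_gt0.
exact: le_lt_trans tu.
Qed.

(* Every flow sends greedily on [0, t0], except that the last packet of [f1] is
   held back until [t0] and placed after all the others. *)
Definition greedy_count f := (K f - (f1 == f))%N.

Definition greedy_arrivals : seq ('I_M * R) :=
  [seq (f, jump (alpha f) m) | f <- enum 'I_M, m <- iota 1 (greedy_count f)].

Definition greedy_packets : seq ('I_M * R) :=
  rcons (sort (fun p q => p.2 <= q.2) greedy_arrivals) (f1, t0).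

Lemma jump_arrival f m t : (0 < m <= K f)%N -> 0 <= t ->
  (jump (alpha f) m < t) = (m <= alpha f t)%N.
Proof.
move=> /andP[m0 mK] ?; apply: jump_lt => //; first exact: alpha_mono.
  by case: (alpha_curve f).
have [u tu Ku] := K_eq f; exists u; last by rewrite Ku.
by apply/ltW; apply: le_lt_trans tu.
Qed.

Lemma greedy_packets_range p : p \in greedy_packets -> 0 <= p.2 <= t0.
Proof.
rewrite mem_rcons inE => /predU1P[->|]; first by rewrite lexx t0_ge0.
rewrite mem_sort => /allpairsPdep[f [m [_]]].
rewrite mem_iota /greedy_count => m_rng -> /=.
have mK : (0 < m <= K f)%N by move: m_rng; lia.
have [u tu Ku] := K_eq f.
rewrite jump_ge0 /=; last first.
  exists u; last by rewrite Ku; case/andP: mK.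
  by apply/ltW; apply: le_lt_trans tu.
(* If the jump came after [t0], the curve would already have reached [K f] at the midpoint, before
   the jump. *)
rewrite leNgt; apply/negP => tj.
have := jump_arrival _ _ ((t0 + jump (alpha f) m) / 2) mK.
have -> : jump (alpha f) m < (t0 + jump (alpha f) m) / 2 = false by lra.
have /K_le Kle : t0 < (t0 + jump (alpha f) m) / 2 by lra.
have mid_ge0 : 0 <= (t0 + jump (alpha f) m) / 2 by have := t0_ge0; lra.
move=> /(_ mid_ge0) /esym/negbT/negP; apply; case/andP: mK => _ mK.
exact: leq_trans mK (Kle f).
Qed.

Lemma greedy_packets_sorted :
  sorted (fun p q : 'I_M * R => p.2 <= q.2) greedy_packets.
Proof.
have tr : transitive (fun p q : 'I_M * R => p.2 <= q.2).
  by move=> p q r; exact: le_trans.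
rewrite sorted_pairwise // pairwise_rcons -sorted_pairwise // sort_sorted; last first.
  by move=> p q; exact: le_total.
rewrite andbT; apply/allP => p ps.
have /andP[] // : 0 <= p.2 <= t0.
by apply: greedy_packets_range; rewrite mem_rcons inE ps orbT.
Qed.

Lemma count_greedy f (Q : pred R) :
  count (fun p => (p.1 == f) && Q p.2) greedy_packets =
  (count (fun m => Q (jump (alpha f) m)) (iota 1 (greedy_count f))
   + ((f1 == f) && Q t0))%N.
Proof.
rewrite /greedy_packets -cats1 count_cat /= addn0; congr addn.
rewrite (permP (permEl (perm_sort _ _))) count_flatten -map_comp sumnE big_map.
rewrite big_enum /= (bigD1 f) //= [X in (_ + X)%N]big1 ?addn0.
  by rewrite count_map; apply: eq_count => m /=; rewrite eqxx.
move=> g /negPf gf; rewrite count_map; apply/eqP; rewrite -leqn0 leqNgt -has_count.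
by apply/hasP => -[m _] /=; rewrite gf.
Qed.

Lemma count_greedy_before f t : 0 <= t ->
  count (fun p => (p.1 == f) && (p.2 < t)) greedy_packets =
  (minn (alpha f t) (greedy_count f) + ((f1 == f) && (t0 < t)%R))%N.
Proof.
move=> t_ge0; rewrite (count_greedy f (fun u => u < t)); congr addn.
rewrite -count_leq_iota; apply: eq_in_count => m; rewrite mem_iota => m_rng.
by apply: jump_arrival => //; move: m_rng; rewrite /greedy_count; lia.
Qed.

Lemma count_greedy_total f : count (fun p => p.1 == f) greedy_packets = K f.
Proof.
have := count_greedy f xpredT; under eq_count => p do rewrite andbT.
move=> ->; rewrite count_predT size_iota /greedy_count andbT.
by have := K_gt0 f; lia.
Qed.

(** On either side of [t0] this is sub-additivity. For [s <= t0 < t], all [K f <= alpha f t] packets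
    have arrived before [t]. If all but the delayed one had arrived before [s], positivity of
    [alpha f (t - s)] allows for it; otherwise sub-additivity applies again. *)
Lemma greedy_curve f s t : 0 <= s -> s <= t ->
  (count (fun p => (p.1 == f) && (p.2 < t)%R) greedy_packets <=
   count (fun p => (p.1 == f) && (p.2 < s)%R) greedy_packets + alpha f (t - s)%R)%N.
Proof.
move=> s0 st; have t_ge0 := le_trans s0 st.
rewrite !count_greedy_before //.
have : (alpha f t <= alpha f s + alpha f (t - s)%R)%N.
  by rewrite -{1}(subrK s t) addrC; apply: alpha_sub => //; rewrite subr_ge0.
have := K_gt0 f; rewrite /greedy_count.
have := @K_le f t.
have : t0 < t -> s <= t0 -> (0 < alpha f (t - s)%R)%N.
  by move=> *; apply: alpha_gt0; lra.
case: (ltP t0 t) => [tt|tt]; case: (ltP t0 s) => [ts|ts]; first lia.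
- by move=> /(_ isT isT) + /(_ isT); lia.
- by have := lt_le_trans ts st; rewrite ltNge tt.
- by lia.
Qed.

End Greedy.

(** * The critical trace *)

Section GreedyTrace.
Context {R : realType} {M : nat} (c : R) (b : R -> R) (beta : R -> \bar R).
Context (alpha : 'I_M -> R -> nat) (L : 'I_M -> R).
Hypothesis c_gt0 : 0 < c.
Hypothesis b_mono : forall s t : R, 0 <= s -> s <= t -> b s <= b t.
Hypothesis b0 : b 0 = 0.
Hypothesis b_lip : forall s t : R, 0 <= s -> s <= t -> b t <= b s + c * (t - s).
Hypothesis b_unbounded : forall x, exists2 s : R, 0 <= s & x <= b s.
Hypothesis beta_le : forall t, 0 <= t -> (beta t <= (b t)%:E)%E.
Hypothesis alpha_curve : forall f, packet_curve (alpha f).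
Hypothesis alpha_sub : forall f, sub_additive (alpha f).
Hypothesis alpha_left : forall f, left_continuous (alpha f).
Hypothesis L_gt0 : forall f, 0 < L f.

Definition interference (f : 'I_M) (t : R) : R :=
  \sum_i L i * right_lim (fun u => (alpha i u)%:R) t - L f.

(** Both bounds on the start time compare [b] with the interference directly, so that they can later
    be derived from [beta], which need not be unbounded. *)
Lemma greedy_trace (f1 : 'I_M) (t0 : R) : 0 <= t0 ->
  exists (T : trace R M) (n : nat),
  [/\ admissible_trace c beta alpha L T, is_pkt T n, flow T n = f1 &
      [/\ len T n = L f1, arr T n = t0,
      forall q, (forall u, 0 <= u -> u < q -> b u < interference f1 t0) ->
        q <= start T n
    & forall h, 0 <= h ->
        (forall v w, 0 <= v -> v + h < w -> interference f1 v <= b w) ->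
        start T n <= t0 + h]].
Proof.
move=> t0_ge0.
have [K HK] := choice (fun f => right_lim_nat _ (alpha_mono _ alpha_curve f) _ t0_ge0).
have K_lim f : right_lim (fun u => (alpha f u)%:R) t0 = (K f)%:R by case: (HK f).
have K_le f u : t0 < u -> (K f <= alpha f u)%N by case: (HK f) => _ + _; apply.
have K_eq f : exists2 u, t0 < u & alpha f u = K f by case: (HK f).
pose pk := greedy_packets alpha f1 t0 K.
pose k := size (greedy_arrivals alpha f1 K).
have size_pk : size pk = k.+1 by rewrite size_rcons size_sort.
(* With the critical packet as default, the range of arrival times holds at every index. *)
pose nthp n := nth (f1, t0) pk n.
have range n : 0 <= (nthp n).2 <= t0.
  have [npk|pkn] := ltnP n (size pk).
    by apply: (greedy_packets_range _ alpha_curve alpha_left _ _ _ t0_ge0 K_le K_eq); exact: mem_nth.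
  by rewrite /nthp nth_default //= lexx t0_ge0.
have last_pk : nthp k = (f1, t0).
  by rewrite /nthp nth_rcons size_sort ltnn eqxx.
pose ar n := (nthp n).2; pose fl n := (nthp n).1; pose ln n := L (fl n).
have ln_gt0 n : 0 < ln n by exact: L_gt0.
have ar_ge0 n : (n < size pk)%N -> 0 <= ar n by case/andP: (range n).
have ar_mono m n : (m <= n)%N -> (n < size pk)%N -> ar m <= ar n.
  move=> mn npk.
  apply: (sorted_leq_nth (leT := fun p q : 'I_M * R => p.2 <= q.2)) => //.
  - by move=> p q r; exact: le_trans.
  - exact: (greedy_packets_sorted _ alpha_curve alpha_left _ _ _ t0_ge0 K_le K_eq).
  - by rewrite inE; exact: leq_ltn_trans npk.
pose st := lazy_start b ar ln.
pose T := Trace (Some (size pk)) fl ln ar st.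
have sum_ln (Q : pred ('I_M * R)) : \sum_(0 <= n < size pk | Q (nthp n)) ln n =
    \sum_i L i * (count (fun p => (p.1 == i) && Q p) pk)%:R.
  by rewrite -sum_by_flow (big_nth (f1, t0)).
have pkts_inE f t : pkts_in T f t =
    ((count (fun p => (p.1 == f) && (p.2 < t)) pk)%:R)%:E.
  rewrite /pkts_in (finite_eseries _ (size pk) (fun n => (fl n == f) && (ar n < t)) (fun=> 1)) //.
  by rewrite -sum1_count natr_sum (big_nth (f1, t0)).
have total_bits : \sum_(0 <= n < size pk) ln n = interference f1 t0 + L f1.
  rewrite (sum_ln xpredT) /interference subrK; apply: eq_bigr => i _.
  rewrite K_lim; congr (_ * _%:R).
  under eq_count do rewrite andbT.
  exact: (count_greedy_total _ alpha_curve _ _ _ t0_ge0 K_eq).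
have prior_bits : \sum_(0 <= n < k) ln n = interference f1 t0.
  apply: (addIr (L f1)); rewrite -total_bits size_pk big_nat_recr //=.
  by rewrite {3}/ln /fl last_pk.
exists T, k; split.
- split.
  + exact: lazy_fifo.
  + exact: lazy_service.
  + move=> f s t s0 st_le; rewrite !pkts_inE -EFinB lee_fin lerBlDl -natrD ler_nat.
    exact: greedy_curve.
  + by move=> f n _ <-.
- by rewrite /is_pkt /= size_pk.
- by rewrite /= /fl last_pk.
split.
- by rewrite /= /ln /fl last_pk.
- by rewrite /= /ar last_pk.
- move=> q Hq; rewrite /=.
  (* The term m = 0 already suffices, since all interfering bits precede the critical packet. *)
  apply: le_trans (lazy_start_ge b ar ln k 0 (leq0n _)).
  rewrite prior_bits; apply: ler_wpDl; first by apply: ar_ge0; rewrite size_pk.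
  apply: le_pinv => // s s0 xs; rewrite leNgt; apply/negP => sq.
  by have := Hq s s0 sq; rewrite ltNge xs.
move=> h h0 Hh; rewrite /= /st.
have [m mk ->] := lazy_start_eq b b0 b_unbounded ar ln k.
have /andP[am0 amt] := range m; rewrite -/(ar m) in am0 amt.
have v0 : 0 <= t0 - ar m by rewrite subr_ge0.
have mpk : (m <= size pk)%N by rewrite size_pk leqW.
have before := bits_before _ _ _ ln_gt0 ar_mono m (ar m) mpk (fun=> lexx _).
rewrite (sum_ln (fun p => p.2 < ar m)) in before.
have bits_x : \sum_(m <= j < k) ln j <= interference f1 (t0 - ar m).
  have split_bits : \sum_(0 <= j < k) ln j =
      \sum_(0 <= j < m) ln j + \sum_(m <= j < k) ln j.
    by rewrite (big_cat_nat (n := m)).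
  rewrite -(lerD2l (\sum_(0 <= j < m) ln j)) -split_bits prior_bits.
  rewrite /interference addrA lerD2r.
  apply: le_trans (lerD before (lexx _)); rewrite -big_split /=.
  (* Flow by flow: of the [K i] packets, those not arrived before [ar m] must number at most the
     right limit of [alpha i] at [t0 - ar m]. *)
  apply: ler_sum => i _; rewrite -mulrDr ler_pM2l // K_lim.
  rewrite -lerBlDl.
  set N := count _ _.
  have [NK|/ltnW KN] := leqP N (K i); last first.
    apply: le_trans (right_lim_ge _ (alpha_mono _ alpha_curve i) _ 0 v0 _) => //.
    by rewrite subr_le0 ler_nat.
  rewrite -natrB //; apply: right_lim_ge => // [s t|u vu].
    exact: alpha_mono.
  (* Past [t0] every packet has arrived, so the arrival curve on an interval of length [u] starting
     at [ar m] bounds [K i - N]. *)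
  have tu : t0 < u + ar m by lra.
  have := greedy_curve _ alpha_curve alpha_sub alpha_left f1 _ _ t0_ge0 K_le K_eq i (ar m) (u + ar m) am0.
  rewrite addrK lerDr => /(_ (le_trans v0 (ltW vu))).
  rewrite count_greedy_before //; last by lra.
  rewrite tu andbT -/N /greedy_count.
  have := K_le i _ tu; have := K_gt0 _ alpha_curve _ _ t0_ge0 K_eq i; lia.
suff : pinv b (\sum_(m <= j < k) ln j) <= t0 - ar m + h by lra.
(* The slack [e] meets the strict inequality [v + h < w] in the hypothesis on [h]. *)
apply/ler_addgt0Pr => e e0; apply: pinv_le; first by lra.
by apply: le_trans bits_x (Hh _ _ v0 _); lra.
Qed.

End GreedyTrace.

(** * Passing from a possibly bounded service curve to an unbounded one *)

Section CriticalTrace.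
Context {R : realType} {M : nat} (c : R) (beta : R -> \bar R).
Context (alpha : 'I_M -> R -> nat) (L : 'I_M -> R).
Hypothesis c_gt0 : 0 < c.
Hypothesis beta_inc : Finc0 beta.
Hypothesis beta_lip : lipschitz_curve c beta.
Hypothesis alpha_curve : forall f, packet_curve (alpha f).
Hypothesis alpha_sub : forall f, sub_additive (alpha f).
Hypothesis alpha_left : forall f, left_continuous (alpha f).
Hypothesis L_gt0 : forall f, 0 < L f.

Lemma interference_ge0 f t : 0 <= t -> 0 <= interference alpha L f t.
Proof.
move=> t0.
have lim_ge1 i : 1 <= right_lim (fun u => (alpha i u)%:R) t.
  apply: (right_lim_ge _ (alpha_mono _ alpha_curve i) _ 1%N) => // u tu.
  by apply: alpha_gt0 => //; exact: le_lt_trans tu.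
rewrite /interference subr_ge0 (bigD1 f) //=.
apply: ler_wpDr; last by rewrite ler_peMr // ltW.
by apply: sumr_ge0 => i _; rewrite mulr_ge0 ?(ltW (L_gt0 _)) // (le_trans ler01).
Qed.

Lemma fine_curve t : 0 <= t -> beta t = (fine (beta t))%:E.
Proof.
move=> t0; case: beta_inc => _ _ b0.
have := beta_lip 0 t (lexx 0) t0; rewrite b0 sube0.
by case: (beta t).
Qed.

(* [beta] may be bounded, so it is replaced by the larger service curve
   [max beta (c * (t - S))], which agrees with it on [0, S]. *)
Lemma critical_trace (f : 'I_M) (t0 S : R) : 0 <= t0 -> 0 <= S ->
  exists (T : trace R M) (n : nat),
  [/\ admissible_trace c beta alpha L T, is_pkt T n, flow T n = f &
      [/\ len T n = L f, arr T n = t0,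
      forall q, q <= S ->
        (q%:E <= lower_pinv beta (interfering_bits alpha L f t0))%E ->
        q <= start T n
    & forall h, 0 <= h -> (hdev (interfering_bits alpha L f) beta <= h%:E)%E ->
        start T n <= t0 + h]].
Proof.
move=> t0_ge0 S_ge0; case: (beta_inc) => _ beta_mono beta0.
pose g u := fine (beta u).
have gE u : 0 <= u -> beta u = (g u)%:E by exact: fine_curve.
have g_mono s t : 0 <= s -> s <= t -> g s <= g t.
  move=> s0 st; have := beta_mono _ _ s0 st.
  by rewrite !gE ?lee_fin // (le_trans s0).
have g_lip s t : 0 <= s -> s <= t -> g t <= g s + c * (t - s).
  move=> s0 st; have t_ge0 := le_trans s0 st.
  have := beta_lip s t s0 t_ge0; rewrite !gE // -EFinB lee_fin.
  rewrite ger0_norm ?subr_ge0 ?g_mono // ger0_norm ?subr_ge0 //.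
  by rewrite lerBlDl.
have g0 : g 0 = 0 by rewrite /g beta0.
pose b u := Num.max (g u) (c * (u - S)).
have b_mono s t : 0 <= s -> s <= t -> b s <= b t.
  move=> s0 st; rewrite /b ge_max !le_max g_mono //=.
  by apply/orP; right; rewrite ler_pM2l // lerD2r.
have b0 : b 0 = 0.
  by rewrite /b g0 sub0r mulrN max_l // oppr_le0 mulr_ge0 // ltW.
have b_lip s t : 0 <= s -> s <= t -> b t <= b s + c * (t - s).
  move=> s0 st; rewrite /b ge_max; apply/andP; split.
    by apply: le_trans (g_lip _ _ s0 st) _; rewrite lerD2r le_max lexx.
  have -> : c * (t - S) = c * (s - S) + c * (t - s) by ring.
  by rewrite lerD2r le_max lexx orbT.
have b_unbounded x : exists2 s : R, 0 <= s & x <= b s.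
  exists (S + `|x| / c); first by rewrite addr_ge0 // divr_ge0 // ltW.
  rewrite /b le_max [S + _]addrC addrK [c * _]mulrC divfK ?gt_eqF //.
  by rewrite ler_norm orbT.
have beta_le t : 0 <= t -> (beta t <= (b t)%:E)%E.
  by move=> ?; rewrite gE // lee_fin /b le_max lexx.
have [T [n [adm nT fn [ln an lo up]]]] := greedy_trace c b beta alpha L c_gt0
  b_mono b0 b_lip b_unbounded beta_le alpha_curve alpha_sub alpha_left L_gt0
  f t0 t0_ge0.
exists T, n; split => //; split => //.
  move=> q qS qx; apply: lo => u u0 uq.
  rewrite /b gt_max; apply/andP; split.
    rewrite ltNge; apply/negP => xu; move: (uq); apply/negP; rewrite -leNgt.
    rewrite -lee_fin; apply: (le_trans qx); apply: ge_ereal_inf.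
    by exists u%:E => //; exists u => //; split => //; rewrite gE // lee_fin.
  (* Before [q <= S] the added branch is negative, hence below the interference. *)
  apply: lt_le_trans (interference_ge0 f _ t0_ge0).
  by rewrite pmulr_rlt0 // subr_lt0; exact: lt_le_trans qS.
move=> h h0 hdev_h; apply: up => // v w v0 vw.
have : (lower_pinv beta (interfering_bits alpha L f v) < w%:E)%E.
  have : (lower_pinv beta (interfering_bits alpha L f v) - v%:E <= h%:E)%E.
    by apply: le_trans hdev_h; apply: ereal_sup_ubound; exists v.
  rewrite leeBlDr // => /le_lt_trans; apply.
  by rewrite -EFinD lte_fin addrC.
move=> /ereal_inf_lt[_ [s [s0 xs] <-]]; rewrite lte_fin => sw.
apply: (@le_trans _ _ (g s)); first by rewrite -lee_fin -gE.
by rewrite /b le_max g_mono // ltW.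
Qed.

End CriticalTrace.

Theorem theorem2 (R : realType) (M : nat) (hM : (0 < M)%N)
    (c : R) (hc : 0 < c)
    (beta : R -> \bar R) (hbeta : Finc0 beta) (hlip : lipschitz_curve c beta)
    (alpha : 'I_M -> R -> nat) (L : 'I_M -> R)
    (halpha : forall f, packet_curve (alpha f))
    (hsub : forall f, sub_additive (alpha f))
    (hleft : forall f, left_continuous (alpha f))
    (hL : forall f, 0 < L f) :
  let flow1 : 'I_M := Ordinal hM in
  (hdev_attained beta alpha L flow1 ->
     exists T : trace R M, admissible_trace c beta alpha L T /\
       exists n, [/\ is_pkt T n, flow T n = flow1
         & (response_time T c n)%:E = Delta_pkt c beta alpha L flow1]) /\
  (forall r : R, (r%:E < Delta_pkt c beta alpha L flow1)%E ->
     exists T : trace R M, admissible_trace c beta alpha L T /\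
       exists n, [/\ is_pkt T n, flow T n = flow1
         & r < response_time T c n]).
Proof.
move=> flow1.
have hdev_ge t : 0 <= t ->
    (lower_pinv beta (interfering_bits alpha L flow1 t) - t%:E
     <= hdev (interfering_bits alpha L flow1) beta)%E.
  by move=> t0; apply: ereal_sup_ubound; exists t.
split.
  move=> [t t_ge0 [d_fin hdevE]].
  set d := (lower_pinv _ _ - _)%E in d_fin hdevE.
  have qE : lower_pinv beta (interfering_bits alpha L flow1 t) = (t + fine d)%:E.
    by move: d_fin; rewrite /d; case: lower_pinv => //= x _; congr EFin; ring.
  have d_ge0 : 0 <= fine d.
    rewrite -lee_fin fineK // -hdevE; apply: le_trans (hdev_ge 0 (lexx 0)).
    by rewrite sube0; apply: le_ereal_inf_tmp => _ [s [s0 _] <-]; rewrite lee_fin.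
  (* Choosing [S] equal to the pseudo-inverse at [t] lets the lower bound be used with [q = S]. *)
  have [T [n [adm nT fn [ln an lo up]]]] := critical_trace _ _ _ _ hc hbeta hlip
    halpha hsub hleft hL flow1 t (t + fine d) t_ge0 (addr_ge0 t_ge0 d_ge0).
  exists T; split => //; exists n; split => //.
  have startE : start T n = t + fine d.
    apply/eqP; rewrite eq_le lo ?qE // andbT up //.
    by rewrite hdevE fineK.
  rewrite /response_time /departure startE ln an /Delta_pkt hdevE -(fineK d_fin) -EFinD.
  by congr EFin; ring.
move=> r; rewrite /Delta_pkt -lteBlDr // -EFinB => r_lt.
have Lc : 0 < L flow1 / c by rewrite divr_gt0.
(* Below [L flow1 / c] the transmission time alone exceeds [r]. *)
have [r_neg|r_pos] := ltP (r - L flow1 / c) 0.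
  have [T [n [adm nT fn [ln an lo up]]]] := critical_trace _ _ _ _ hc hbeta hlip
    halpha hsub hleft hL flow1 0 0 (lexx 0) (lexx 0).
  exists T; split => //; exists n; split => //.
  have [[+ _] _ _ _] := adm; move=> /(_ n nT)[_ _ arr_start].
  by rewrite /response_time /departure ln; lra.
move: r_lt => /ereal_sup_gt[_ [t t_ge0 <-]].
rewrite lteBrDr // -EFinD => r_lt.
(* The pseudo-inverse may be infinite when [beta] is bounded; any large enough real [q] then
   serves. *)
have [q r_q qx] : exists2 q : R, r - L flow1 / c + t < q &
    (q%:E <= lower_pinv beta (interfering_bits alpha L flow1 t))%E.
  move: r_lt; case: lower_pinv => [q| |//]; first by rewrite lte_fin; exists q.
  by exists (r - L flow1 / c + t + 1); rewrite ?ltrDl ?leey.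
have [T [n [adm nT fn [ln an lo up]]]] := critical_trace _ _ _ _ hc hbeta hlip
  halpha hsub hleft hL flow1 t `|q| t_ge0 (normr_ge0 q).
exists T; split => //; exists n; split => //.
have := lo _ (ler_norm q) qx.
by rewrite /response_time /departure ln an; lra.
Qed.
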